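(* Let $X$ be a real Banach space, $J$ a nonempty index set, and let $f_j:X\to\mathbb{R}\cup\{\infty\}$, $j\in J$, be proper lower semicontinuous convex functions. Let $\mathcal{F}:l_\infty(J)\rightrightarrows X$ be given by $\mathcal{F}(p)=\{x\in X\mid f_j(x)\le p_j\ \text{for all } j\in J\}$. For any $\overline{x}\in\mathcal{F}(0)$ we have $$\sup\Big\{\|u^*\|^{-1}\;\Big|\;\big(u^*,\langle u^*,\overline{x}\rangle\big)\in\mathrm{cl}^*\,\mathrm{co}\Big(\bigcup_{j\in J}\mathrm{gph}\,f_j^*\Big)\Big\}\le\|D^*\mathcal{F}(0,\overline{x})\|\le\mathrm{lip}\,\mathcal{F}(0,\overline{x}).$$ If furthermore either the set $\bigcup_{j\in J}\mathrm{dom}\,f_j^*$ is bounded in $X^*$ or the space $X$ is reflexive, then $$\sup\Big\{\|u^*\|^{-1}\;\Big|\;\big(u^*,\langle u^*,\overline{x}\rangle\big)\in\mathrm{cl}^*\,\mathrm{co}\Big(\bigcup_{j\in J}\mathrm{gph}\,f_j^*\Big)\Big\}=\|D^*\mathcal{F}(0,\overline{x})\|=\mathrm{lip}\,\mathcal{F}(0,\overline{x}).$$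
   Context: $l_\infty(J)$ is the Banach space of bounded functions $p=(p_j)_{j\in J}$ with norm $\|p\|=\sup_{j\in J}|p_j|$. $f_j^*:X^*\to\mathbb{R}\cup\{\infty\}$ is the Fenchel–Legendre conjugate $f_j^*(u^* )=\sup\{\langle u^*,x\rangle-f_j(x)\mid x\in X\}$; $\mathrm{dom}\,f_j^*=\{u^*\mid f_j^*(u^* )<\infty\}$ and $\mathrm{gph}\,f_j^*=\{(u^*,f_j^*(u^* ))\mid u^*\in\mathrm{dom}\,f_j^*\}\subset X^*\times\mathbb{R}$. Notation. $\mathrm{co}$ is the convex hull; $\mathrm{cl}^*$ is the weak$^*$ closure (here in $X^*\times\mathbb{R}$, dual of $X\times\mathbb{R}$); norms on dual spaces are the dual norms. Conventions: $\sup\varnothing:=0$ and $0^{-1}:=\infty$. Exact Lipschitzian bound. A set-valued map $F:Z\rightrightarrows Y$ between Banach spaces is Lipschitz-like around $(\bar z,\bar y)\in\mathrm{gph}\,F$ with modulus $\ell\ge0$ if there are neighborhoods $U$ of $\bar z$ and $V$ of $\bar y$ with $F(z)\cap V\subset F(u)+\ell\|z-u\|\mathbb{B}_Y$ for all $z,u\in U$, where $\mathbb{B}_Y$ is the closed unit ball. $\mathrm{lip}\,F(\bar z,\bar y)\in[0,\infty]$ is the infimum of all such moduli $\ell$ over all possible $(\ell,U,V)$, and equals $\infty$ if $F$ is not Lipschitz-like around $(\bar z,\bar y)$. Coderivative. $D^*F(\bar z,\bar y)(y^* ):=\{z^*\in Z^*\mid (z^*,-y^* )\in N((\bar z,\bar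 y);\mathrm{gph}\,F)\}$ for $y^*\in Y^*$, where $N$ is the basic (limiting, Mordukhovich) normal cone; for the map considered here the graph is convex, and then $N(w;\Omega)=\{w^*\mid \langle w^*,v-w\rangle\le 0\ \forall v\in\Omega\}$ is the normal cone of convex analysis. The coderivative norm is $\|D^*F(\bar z,\bar y)\|:=\sup\{\|z^*\|\mid z^*\in D^*F(\bar z,\bar y)(y^* ),\ \|y^*\|\le1\}\in[0,\infty]$. *)

(* Defs.v *)
(* MathComp-Analysis; the scalars are an arbitrary realType R. *)
From HB Require Import structures.
From mathcomp Require Import all_boot all_order all_algebra.
From mathcomp Require Import all_classical all_reals all_analysis.

Set Implicit Arguments.
Unset Strict Implicit.
Unset Printing Implicit Defensive.
Import Order.TTheory GRing.Theory Num.Theory.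
Import numFieldNormedType.Exports.
Local Open Scope classical_set_scope.
Local Open Scope ring_scope.

Section sup_norm_on.
Context {R : realType} {T : Type}.
Implicit Types (A : set T) (f g : T -> R).

Definition sup_norm_on A f : R := sup [set `|f x| | x in A].

Definition bounded_on A f := exists M : R, forall x, A x -> `|f x| <= M.

Lemma sup_norm_on_ub A f x : bounded_on A f -> A x -> `|f x| <= sup_norm_on A f.
Proof.
move=> [M fM] Ax; apply: ub_le_sup; last by exists x.
by exists M => _ [y Ay <-]; exact: fM.
Qed.

Lemma sup_norm_on_le A f M : 0 <= M -> (forall x, A x -> `|f x| <= M) ->
  sup_norm_on A f <= M.
Proof.
move=> M0 fM; have [->|/set0P[x Ax]] := eqVneq A set0.
  by rewrite /sup_norm_on image_set0 sup0.
apply: ge_sup; first by exists `|f x|, x.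
by move=> _ [y Ay <-]; exact: fM.
Qed.

Lemma sup_norm_on_ge0 A f : 0 <= sup_norm_on A f.
Proof.
rewrite /sup_norm_on; set B := (X in sup X).
have [[[b Bb] ubB]|/sup_out->//] := pselect (has_sup B).
by rewrite (le_trans _ (ub_le_sup ubB Bb))//; case: Bb => x _ <-.
Qed.

Lemma sup_norm_onD A f g : bounded_on A f -> bounded_on A g ->
  sup_norm_on A (f \+ g) <= sup_norm_on A f + sup_norm_on A g.
Proof.
move=> bf bg; apply: sup_norm_on_le => [|x Ax].
  by rewrite addr_ge0// sup_norm_on_ge0.
by rewrite (le_trans (ler_normD _ _))// lerD// sup_norm_on_ub.
Qed.

Lemma sup_norm_onZ A f (l : R) : bounded_on A f ->
  sup_norm_on A (fun x => l * f x) = `|l| * sup_norm_on A f.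
Proof.
have le_supZ k g : bounded_on A g ->
    sup_norm_on A (fun x => k * g x) <= `|k| * sup_norm_on A g.
  move=> bg; apply: sup_norm_on_le => [|x Ax].
    by rewrite mulr_ge0// sup_norm_on_ge0.
  by rewrite normrM ler_wpM2l// sup_norm_on_ub.
move=> bf; apply/eqP; rewrite eq_le le_supZ//=.
have [->|l0] := eqVneq l 0; first by rewrite normr0 mul0r sup_norm_on_ge0.
rewrite -ler_pdivlMl ?normr_gt0// -normfV.
have -> : sup_norm_on A f = sup_norm_on A (fun x => l^-1 * (l * f x)).
  by congr sup_norm_on; apply/funext => x; rewrite mulKf.
apply: le_supZ; case: bf => M fM; exists (`|l| * M) => x Ax.
by rewrite normrM ler_wpM2l// fM.
Qed.

End sup_norm_on.

Section linfty.
Context (R : realType) (J : Type).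

Definition linfty_pred : {pred J -> R^o} := [pred p | `[< bounded_fun p >]].

Record linfty := Linfty {
  linfty_fun :> J -> R^o ;
  linftyP : linfty_fun \in linfty_pred }.

HB.instance Definition _ := [isSub of linfty for linfty_fun].
HB.instance Definition _ := [Choice of linfty by <:].

Lemma linfty_predP (p : J -> R^o) :
  reflect (bounded_on setT p) (p \in linfty_pred).
Proof.
rewrite inE; apply: (iffP (asboolP _)) => [/pinfty_ex_gt0[M _ pM]|[M pM]].
  by exists M => j _; exact: pM.
by exists M; split=> [|N /ltW MN j _]; [exact: num_real | exact: le_trans (pM j I) MN].
Qed.

Lemma linfty_submod_closed : submod_closed linfty_pred.
Proof.
split; first by apply/linfty_predP; exists 0 => j _; rewrite normr0.
move=> a p q /linfty_predP[M pM] /linfty_predP[N qN]; apply/linfty_predP.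
exists (`|a| * M + N) => j _.
rewrite (le_trans (ler_normD _ _))// lerD// ?qN//.
by rewrite normrZ ler_wpM2l// pM.
Qed.

HB.instance Definition _ :=
  GRing.isSubmodClosed.Build R (J -> R^o) linfty_pred linfty_submod_closed.
HB.instance Definition _ := [SubChoice_isSubLmodule of linfty by <:].

Definition linfty_norm (p : linfty) : R := sup_norm_on setT p.

Let linfty_bounded (p : linfty) : bounded_on setT p.
Proof. exact/linfty_predP/linftyP. Qed.

Let linfty_normD (p q : linfty) :
  linfty_norm (p + q) <= linfty_norm p + linfty_norm q.
Proof. exact: sup_norm_onD. Qed.

Let linfty_normZ (a : R) (p : linfty) :
  linfty_norm (a *: p) = `|a| * linfty_norm p.
Proof. exact: sup_norm_onZ. Qed.

Let linfty_norm0_eq0 (p : linfty) : linfty_norm p = 0 -> p = 0.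
Proof.
move=> p0; apply/val_inj/funext => j; apply/eqP; rewrite -normr_le0.
by rewrite -p0; exact: sup_norm_on_ub.
Qed.

HB.instance Definition _ := Lmodule_isNormed.Build R linfty
  linfty_normD linfty_normZ linfty_norm0_eq0.

End linfty.

Section dual.
Context (R : realType) (E : normedModType R).

Definition dual_pred : {pred E -> R^o} :=
  [pred u | `[< linear u /\ continuous u >]].

Record dual := Dual {
  dual_fun :> E -> R^o ;
  dualP : dual_fun \in dual_pred }.

HB.instance Definition _ := [isSub of dual for dual_fun].
HB.instance Definition _ := [Choice of dual by <:].

Lemma dual_submod_closed : submod_closed dual_pred.
Proof.
split.
  apply/asboolP; split; last exact: cst_continuous.
  by move=> a x y; rewrite scaler0 addr0.
move=> a u v /asboolP[ul uc] /asboolP[vl vc]; apply/asboolP; split.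
  move=> b x y; rewrite /= !fctE ul vl !scalerDr !scalerA mulrC.
  by rewrite addrACA.
move=> x; apply: continuousD; last exact: vc.
by apply: continuousZr; exact: uc.
Qed.

HB.instance Definition _ :=
  GRing.isSubmodClosed.Build R (E -> R^o) dual_pred dual_submod_closed.
HB.instance Definition _ := [SubChoice_isSubLmodule of dual by <:].

Definition dual_norm (u : dual) : R := sup_norm_on [set x | `|x| <= 1] u.

Lemma dual_linear (u : dual) : linear u.
Proof. by have /asboolP[] := dualP u. Qed.

Lemma dual_continuous (u : dual) : continuous u.
Proof. by have /asboolP[] := dualP u. Qed.

Lemma dual_bounded (u : dual) : exists M, forall x, `|u x| <= M * `|x|.
Proof.
pose f : {linear E -> R^o} :=
  HB.pack (dual_fun u) (GRing.isLinear.Build _ _ _ _ _ (dual_linear u)).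
have /linear_boundedP/pinfty_ex_gt0[M _ uM] : bounded_near f (nbhs 0).
  by apply/linear_bounded_continuous; exact: dual_continuous.
by exists M.
Qed.

Let dual_bounded_on (u : dual) : bounded_on [set x | `|x| <= 1] u.
Proof.
have [M uM] := dual_bounded u; exists `|M| => x /= x1.
rewrite (le_trans (uM x))// (le_trans (ler_norm _))// normrM normr_id.
by rewrite ler_piMr.
Qed.

Let dual_normD (u v : dual) : dual_norm (u + v) <= dual_norm u + dual_norm v.
Proof. exact: sup_norm_onD. Qed.

Let dual_normZ (a : R) (u : dual) : dual_norm (a *: u) = `|a| * dual_norm u.
Proof. exact: sup_norm_onZ. Qed.

Let dual_norm0_eq0 (u : dual) : dual_norm u = 0 -> u = 0.
Proof.
have uZ (a : R) x : u (a *: x) = a * u x.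
  have u0 : u 0 = 0.
    by have := dual_linear u (-1) 0 0; rewrite scaler0 addr0 scaleN1r addNr.
  by have := dual_linear u a x 0; rewrite !addr0 u0 addr0.
move=> u0; apply/val_inj/funext => x /=; apply/eqP.
have [->|x0] := eqVneq x 0.
  by have /eqP := uZ 0 0; rewrite scale0r mul0r.
have nx : `|x|^-1 != 0 by rewrite invr_eq0 normr_eq0.
rewrite -(mulrI_eq0 _ (mulfI nx)) -uZ -normr_le0.
rewrite -u0; apply: sup_norm_on_ub => //=.
by rewrite normrZ normfV normr_id mulVf// normr_eq0.
Qed.

HB.instance Definition _ := Lmodule_isNormed.Build R dual
  dual_normD dual_normZ dual_norm0_eq0.

End dual.

Definition reflexive_space (R : realType) (E : normedModType R) :=
  forall phi : dual (dual E), exists x : E, forall u : dual E, phi u = u x.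

(* Convention sup set0 = 0, used for suprema of quantities in [0, +oo]. *)
Definition esup0 (R : realType) (A : set (\bar R)) : \bar R :=
  if `[< A = set0 >] then 0%E else ereal_sup A.

Section convex_analysis.
Context {R : realType} {X : normedModType R}.
Implicit Types (f : X -> \bar R) (u : dual X).
Local Open Scope ereal_scope.

Definition proper_fun f :=
  (forall x, f x != -oo) /\ exists x, f x < +oo.

(* With 0 * +oo = 0 the inequality is trivial at t = 0 and t = 1. *)
Definition convex_efun f := forall x y (t : R), (0 <= t <= 1)%R ->
  f (t *: x + (1 - t) *: y)%R <= t%:E * f x + (1 - t)%:E * f y.

Definition conjugate f u : \bar R := ereal_sup [set (u x)%:E - f x | x in setT].

Definition dom_conj f : set (dual X) := [set u | conjugate f u < +oo].

Definition gph_conj f : set (dual X * R^o) :=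
  [set w | conjugate f w.1 = (w.2 : R)%:E].

End convex_analysis.

Definition convex_hull (R : realType) (V : lmodType R) (A : set V) : set V :=
  smallest (fun C : set (convex_lmodType V) => convex_set C) A.

(* (u, r) in X^* x R is the functional (x, s) |-> u x + r s on X x R, and the
   weak^* topology is that of pointwise convergence of these functionals. *)
Definition pair_functional (R : realType) (X : normedModType R)
    (w : dual X * R^o) : {ptws (X * R^o)%type -> R^o} :=
  fun z => w.1 z.1 + w.2 * z.2.

Definition weakstar_closure (R : realType) (X : normedModType R)
    (A : set (dual X * R^o)) : set (dual X * R^o) :=
  closure (A : set (initial_topology (@pair_functional R X))).

Section set_valued.
Context {R : realType} {Z Y : normedModType R}.
Implicit Types (F : Z -> set Y) (zb : Z) (yb : Y).

Definition gph F : set (Z * Y) := [set w | F w.1 w.2].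

Definition lipschitz_like F zb yb (l : R) :=
  0 <= l /\ exists U V, [/\ nbhs zb U, nbhs yb V &
    forall z u, U z -> U u ->
      F z `&` V `<=`
        [set y + (l * `|z - u|) *: b | y in F u & b in [set b : Y | `|b| <= 1]]].

Definition lip F zb yb : \bar R :=
  ereal_inf [set l%:E | l in lipschitz_like F zb yb].

(* Normal cone of convex analysis, to which the basic (limiting) normal cone
   reduces for convex Omega; Z^* x Y^* is identified with the dual of Z x Y. *)
Definition normal_cone (Omega : set (Z * Y)) (w : Z * Y) :
    set (dual Z * dual Y) :=
  [set n : dual Z * dual Y | forall v, Omega v -> n.1 (v.1 - w.1) + n.2 (v.2 - w.2) <= 0].

Definition coderivative F zb yb (ys : dual Y) : set (dual Z) :=
  [set zs | normal_cone (gph F) (zb, yb) (zs, - ys)].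

Definition coderivative_norm F zb yb : \bar R :=
  esup0 [set `|zs|%:E | zs in
    \bigcup_(ys in [set ys : dual Y | `|ys| <= 1]) coderivative F zb yb ys].

End set_valued.

Definition feasible (R : realType) (X : normedModType R) (J : Type)
    (f : J -> X -> \bar R) (p : linfty R J) : set X :=
  [set x | forall j, (f j x <= (p j : R)%:E)%E].

(* The graph of [feasible f] is convex, so [normal_cone] applies to it. *)
Lemma gph_feasible_convex (R : realType) (X : normedModType R) (J : Type)
    (f : J -> X -> \bar R) : (forall j, convex_efun (f j)) ->
  convex_set (gph (feasible f) : set (convex_lmodType (linfty R J * X)%type)).
Proof.
move=> fc [p x] [q y] t; rewrite !inE/gph/feasible/= => fx fy j.
have t01 : 0 <= t%:num <= 1 by rewrite ge0/= le1.
have t0 : (0 <= t%:num%:E)%E by rewrite lee_fin.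
have t1 : (0 <= (1 - t%:num)%:E :> \bar R)%E by rewrite lee_fin subr_ge0 le1.
apply: (le_trans (fc j x y t%:num t01)).
rewrite -[leRHS]/((t%:num * p j + (1 - t%:num) * q j)%:E).
by rewrite [leRHS]EFinD !EFinM leeD// lee_wpmul2l.
Qed.

(* Main.v *)
Require Import Defs.
From HB Require Import structures.
From mathcomp Require Import all_boot all_order all_algebra.
From mathcomp Require Import all_classical all_reals all_analysis.
From mathcomp Require Import ring lra.

(** Write G for the union of the graphs of the conjugates f_j^* and W for the
    weak^* closure of its convex hull.  The three quantities are compared in a
    cycle: S <= ||D^*F|| <= lip F <= S.

    S <= ||D^*F||.  If (u, <u, xb>) lies in W and f_j(x) <= M for all j, the
    Fenchel-Young inequality bounds v(x) - g by M on G, hence on W, so that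
    u(x - xb) <= M.  Applied with M = ||p + t 1|| - t at the points x of F(p),
    this is the hypothesis under which the Hahn-Banach theorem gives a
    functional p^* on l_oo(J) with p^*(1) = -1 and p^*(p) + u(x - xb) <= 0 on
    the graph of F ([multiplier_normal]).  Then s p^* is in D^*F(- s u) and has
    norm at least s, for every s >= 0 with s ||u|| <= 1.

    ||D^*F|| <= lip F.  A Lipschitz modulus l lets xb follow a small change z
    of the parameter at a distance at most l ||z||; inserting the displaced
    point in the inequality that defines the normal cone bounds the coderivative
    by l ([coderivative_norm_le_lip]).

    lip F <= S.  For every K > 0 one of two things happens
    ([slater_or_multiplier]): there is a displacement w with
    sup_j f_j(xb + w) < - K ||w||, or there is u with ||u|| <= K and
    (u, <u, xb>) in W.  The second one says 1/K <= S.  In the first one xb + w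
    satisfies all the inequalities with room to spare, also for nearby
    parameters, and moving from a point x of F(p) near xb towards xb + w
    repairs a violation of size ||p - q|| at the cost of a displacement of at
    most ||p - q|| / K; thus 1/K is a Lipschitz modulus
    ([slater_lipschitz_like]).  The alternative itself is a Hahn-Banach
    argument: a u with ||u|| <= K and u(x) + s u(xb) <= sup_G (v(x) + s g) for
    all (x, s) belongs to W by weak^* separation, and when no such u exists the
    obstruction is a pair (w, s) which the biconjugate theorem turns into the
    displacement w of the first case.

    All separation arguments are instances of [convex_hahn_banach]: if
    b + N(-w) >= 0 on a convex set of pairs (w, b), where N is sublinear, then
    some linear u <= N satisfies u(w) <= b on that set. *)

Set Implicit Arguments.
Unset Strict Implicit.
Unset Printing Implicit Defensive.
Import Order.TTheory GRing.Theory Num.Theory.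
Import numFieldNormedType.Exports.
Local Open Scope classical_set_scope.
Local Open Scope ring_scope.

(** * Sublinear functionals and the Hahn-Banach theorem *)

Section hahn_banach.
Context {R : realType} {V : lmodType R}.
Implicit Types (p q : V -> R) (x y : V).

Definition sublinear p :=
  (forall x y, p (x + y) <= p x + p y) /\
  (forall a x, 0 <= a -> p (a *: x) <= a * p x).

Lemma sublinear0 p : sublinear p -> p 0 = 0.
Proof.
move=> [pD pZ]; apply/eqP; rewrite eq_le; apply/andP; split.
  by have := pZ 0 0 (lexx _); rewrite scale0r mul0r.
by have := pD 0 0; rewrite addr0 lerDl.
Qed.

Lemma sublinearZ p a x : sublinear p -> 0 <= a -> p (a *: x) = a * p x.
Proof.
move=> sp a0; apply/eqP; rewrite eq_le sp.2//=.
have [->|an0] := eqVneq a 0; first by rewrite scale0r sublinear0// mul0r.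
rewrite -ler_pdivlMl ?lt_def ?an0//.
have := sp.2 a^-1 (a *: x); rewrite scalerA mulVf// scale1r; apply.
by rewrite invr_ge0.
Qed.

Lemma sublinearN p x : sublinear p -> - p (- x) <= p x.
Proof. by move=> sp; rewrite lerNl -subr_ge0 opprK addrC -(sublinear0 sp) -(addrN x) sp.1. Qed.

(** The common form of the three infima built below: over a chain of sublinear
    functionals, over the translates of one functional, and over a cone. *)
Lemma inf_sublinear (S : V -> set R) :
  (forall x, S x !=set0) -> (forall x, has_lbound (S x)) ->
  (forall x y a b, S x a -> S y b -> exists2 c, S (x + y) c & c <= a + b) ->
  (forall k x a, 0 <= k -> S x a -> exists2 c, S (k *: x) c & c <= k * a) ->
  sublinear (fun x => inf (S x)).
Proof.
move=> S0 Slb SD SZ; split => [x y|k x k0].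
  rewrite -lerBlDr; apply: lb_le_inf => // a Sa.
  rewrite lerBlDr -lerBlDl; apply: lb_le_inf => // b Sb.
  rewrite lerBlDl; have [c Sc cab] := SD _ _ _ _ Sa Sb.
  exact: le_trans (ge_inf _ Sc) cab.
have infZ a : S x a -> inf (S (k *: x)) <= k * a.
  by move=> /(SZ _ _ _ k0)[c Sc ?]; exact: le_trans (ge_inf _ Sc) _.
have [kz|kn0] := eqVneq k 0.
  by have [a /infZ] := S0 x; rewrite kz !mul0r.
rewrite -ler_pdivrMl ?lt_def ?kn0//; apply: lb_le_inf => // a /infZ.
by rewrite ler_pdivrMl ?lt_def ?kn0.
Qed.

(** Zorn's lemma for the reversed pointwise order.  The infimum of a chain below
    p is finite because q(x) >= - q(-x) >= - p(-x) for every q <= p. *)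
Lemma minimal_sublinear p : sublinear p ->
  exists q, [/\ sublinear q, forall x, q x <= p x &
    forall q', sublinear q' -> (forall x, q' x <= q x) -> forall x, q x <= q' x].
Proof.
move=> sp; pose T := {q : V -> R | sublinear q /\ forall x, q x <= p x}.
pose below (s t : T) := `[< forall x, sval t x <= sval s x >].
have [|||[q [sq qp]] qmin] := @ZL_preorder T (exist _ p (conj sp (fun=> lexx _))) below.
- by move=> t; apply/asboolP.
- move=> r s t /asboolP rs /asboolP st; apply/asboolP => x.
  exact: le_trans (st x) (rs x).
- move=> A Atot.
  have [A0|/set0P[t0 At0]] := eqVneq A set0.
    by exists (exist _ p (conj sp (fun=> lexx _))) => s; rewrite A0.
  pose S x := [set sval t x | t in A].
  have Slb x : has_lbound (S x).
    exists (- p (- x)) => _ [[q [sq qp]] _ <-] /=.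
    by apply: le_trans (sublinearN x sq); rewrite lerN2.
  have sS : sublinear (fun x => inf (S x)).
    apply: inf_sublinear => //.
    + by move=> x; exists (sval t0 x), t0.
    + move=> x y _ _ [s As <-] [t At <-].
      have [/asboolP st|/asboolP ts] := Atot _ _ As At.
        exists (sval t (x + y)); first by exists t.
        by rewrite (le_trans ((svalP t).1.1 _ _))// lerD2r.
      exists (sval s (x + y)); first by exists s.
      by rewrite (le_trans ((svalP s).1.1 _ _))// lerD2l.
    + move=> k x _ k0 [s As <-]; exists (sval s (k *: x)); first by exists s.
      exact: (svalP s).1.2.
  have Sle t x : A t -> inf (S x) <= sval t x.
    by move=> At; apply: ge_inf => //; exists t.
  have Sp x : inf (S x) <= p x := le_trans (Sle _ x At0) ((svalP t0).2 x).
  exists (exist _ (fun x => inf (S x)) (conj sS Sp)).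
  by move=> s As; apply/asboolP => x /=; exact: Sle.
- exists q; split => // q' sq' q'q.
  have q'p x : q' x <= p x by exact: le_trans (q'q x) (qp x).
  have := qmin (exist _ q' (conj sq' q'p)).
  by move=> /(_ (asboolT q'q))/asboolP.
Qed.

(** For a fixed y, the functional z |-> inf_(t >= 0) q(z + t y) - t q(y) is
    sublinear and below q, hence equal to q when q is minimal; its term t = 1
    then reads q(x) <= q(x + y) - q(y). *)
Lemma minimal_sublinear_superadditive q : sublinear q ->
  (forall q', sublinear q' -> (forall x, q' x <= q x) -> forall x, q x <= q' x) ->
  forall x y, q x + q y <= q (x + y).
Proof.
move=> sq qmin x y.
pose S z := [set q (z + t *: y) - t * q y | t in [set t | 0 <= t]].
have Slb z : has_lbound (S z).
  exists (- q (- z)) => _ [t t0 <-].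
  rewrite lerBrDl -(sublinearZ _ sq t0) lerBlDr.
  by have := sq.1 (z + t *: y) (- z); rewrite addrAC addrN add0r.
have Sle z t : 0 <= t -> inf (S z) <= q (z + t *: y) - t * q y.
  by move=> t0; apply: ge_inf => //; exists t.
rewrite -lerBrDr; apply: le_trans (qmin (fun z => inf (S z)) _ _ x) _.
- apply: inf_sublinear => //.
  + by move=> z; exists (q (z + 0 *: y) - 0 * q y), 0 => /=.
  + move=> z w _ _ [s s0 <-] [t t0 <-]; exists (q (z + w + (s + t) *: y) - (s + t) * q y).
      by exists (s + t) => //; exact: addr_ge0.
    have := sq.1 (z + s *: y) (w + t *: y); rewrite addrACA -scalerDl; lra.
  + move=> k z _ k0 [s s0 <-]; exists (q (k *: z + (k * s) *: y) - k * s * q y).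
      by exists (k * s) => //; exact: mulr_ge0.
    by rewrite -scalerA -scalerDr sublinearZ// mulrBr mulrA.
- by move=> z; apply: le_trans (Sle z 0 (lexx _)) _; rewrite scale0r addr0 mul0r subr0.
- by apply: le_trans (Sle x 1 ler01) _; rewrite scale1r mul1r.
Qed.

(** A minimal sublinear functional is additive, hence odd, hence linear; no
    extension from subspaces is involved. *)
Theorem hahn_banach p : sublinear p ->
  exists2 u : V -> R^o, linear u & forall x, u x <= p x.
Proof.
move=> /minimal_sublinear[q [sq qp qmin]]; exists q => //.
have qD x y : q (x + y) = q x + q y.
  by apply/eqP; rewrite eq_le sq.1 minimal_sublinear_superadditive.
have qN x : q (- x) = - q x.
  by apply/eqP; rewrite -addr_eq0 -qD addNr sublinear0.
move=> a x y; rewrite qD; congr (_ + _).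
have [a0|/ltW a0] := leP 0 a; first by rewrite sublinearZ.
by rewrite -[a]opprK scaleNr qN sublinearZ ?oppr_ge0// scaleNr.
Qed.

End hahn_banach.

(** * Linear functionals below a convex set *)

Section convex_hahn_banach.
Context {R : realType} {V : lmodType R}.
Implicit Types (N : V -> R) (C D : set (V * R^o)).

Lemma convex_setP (W : lmodType R) (A : set W) :
  convex_set (A : set (convex_lmodType W)) <->
  forall x y (t : R), 0 <= t <= 1 -> A x -> A y -> A (t *: x + (1 - t) *: y).
Proof.
split=> [cA x y t /andP[t0 t1] Ax Ay|cA x y t].
  by have := cA x y (Itv01 t0 t1); rewrite !inE; apply.
by rewrite !inE; apply: cA; rewrite ge0/= le1.
Qed.

(** The Hahn-Banach theorem is applied to the infimal convolution
    y |-> inf_D b + N(y - w), which is finite exactly because b + N(- w) >= 0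
    on D.  It is below N, by the point 0 of D, and below b at w, by the point
    (w, b) itself. *)
Lemma cone_hahn_banach N D : sublinear N ->
  D 0 -> (forall v w, D v -> D w -> D (v + w)) ->
  (forall a v, 0 <= a -> D v -> D (a *: v)) ->
  (forall w, D w -> 0 <= w.2 + N (- w.1)) ->
  exists u : V -> R^o,
    [/\ linear u, forall x, u x <= N x & forall w, D w -> u w.1 <= w.2].
Proof.
move=> sN D0 DD DZ DN.
pose S y := [set w.2 + N (y - w.1) | w in D].
have Slb y : has_lbound (S y).
  exists (- N (- y)) => _ [w Dw <-].
  have := sN.1 (y - w.1) (- y); have := DN _ Dw.
  by rewrite addrAC addrN add0r; lra.
have Sle y w : D w -> inf (S y) <= w.2 + N (y - w.1).
  by move=> Dw; apply: ge_inf => //; exists w.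
have sS : sublinear (fun y => inf (S y)).
  apply: inf_sublinear => //.
  - by move=> y; exists ((0 : V * R^o).2 + N (y - (0 : V * R^o).1)), 0.
  - move=> x y _ _ [v Dv <-] [w Dw <-].
    exists ((v + w).2 + N (x + y - (v + w).1)); first by exists (v + w) => //; exact: DD.
    have := sN.1 (x - v.1) (y - w.1); rewrite addrACA -opprD /=.
    by rewrite -[v.2 + w.2]/(v.2 + w.2 : R); lra.
  - move=> k x _ k0 [w Dw <-].
    exists ((k *: w).2 + N (k *: x - (k *: w).1)); first by exists (k *: w) => //; exact: DZ.
    by rewrite /= -scalerBr sublinearZ// mulrDr.
have [u lu uS] := hahn_banach sS.
exists u; split => //.
  by move=> x; rewrite (le_trans (uS x))// (le_trans (Sle x _ D0))//= add0r subr0.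
move=> w Dw; rewrite (le_trans (uS _))// (le_trans (Sle _ _ Dw))//.
by rewrite subrr sublinear0// addr0.
Qed.

(** Both the hypothesis and the conclusion pass from C to the cone that it
    generates. *)
Theorem convex_hahn_banach N C : sublinear N ->
  convex_set (C : set (convex_lmodType (V * R^o)%type)) ->
  (forall w, C w -> 0 <= w.2 + N (- w.1)) ->
  exists u : V -> R^o,
    [/\ linear u, forall x, u x <= N x & forall w, C w -> u w.1 <= w.2].
Proof.
move=> sN /convex_setP cC CN.
(* The case t = 0 leaves c arbitrary, so that 0 is in D when C is empty. *)
pose D := [set w | exists t c, [/\ 0 <= t, w = t *: c & t = 0 \/ C c]].
have [||||u [lu uN uD]] := @cone_hahn_banach N D sN.
- by exists 0, 0; split => //; [rewrite scaler0|left].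
- move=> _ _ [s [c [s0 -> [->|Cc]]]] [t [d [t0 -> [->|Cd]]]].
  + by exists 0, 0; split => //; [rewrite !scale0r addr0 | left].
  + by exists t, d; split => //; [rewrite scale0r add0r | right].
  + by exists s, c; split => //; [rewrite scale0r addr0 | right].
  + have [st0|stn0] := eqVneq (s + t) 0.
      have [-> ->] : s = 0 /\ t = 0 by split; lra.
      by exists 0, 0; split => //; [rewrite !scale0r addr0 | left].
    have stp : 0 < s + t by rewrite lt_def stn0 addr_ge0.
    exists (s + t), ((s / (s + t)) *: c + (1 - s / (s + t)) *: d); split.
    * exact: ltW.
    * have -> : 1 - s / (s + t) = t / (s + t) by field.
      by rewrite scalerDr !scalerA ![(s + t) * _]mulrC !divfK.
    * right; apply: cC => //; rewrite divr_ge0 ?(ltW stp)//=.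
      by rewrite ler_pdivrMr// mul1r lerDl.
- move=> a _ a0 [t [c [t0 -> tc]]]; exists (a * t), c; split.
  + exact: mulr_ge0.
  + by rewrite scalerA.
  + by case: tc => [->|]; [left; rewrite mulr0|right].
- move=> _ [t [c [t0 -> [->|Cc]]]].
    by rewrite scale0r /= oppr0 sublinear0// addr0.
  by rewrite /= -scalerN sublinearZ// -mulrDr mulr_ge0// CN.
exists u; split => // w Cw; apply: uD; exists 1, w.
by split => //; [rewrite scale1r|right].
Qed.

End convex_hahn_banach.

Section convex_hahn_banach_normed.
Context {R : realType} {E : normedModType R}.

HB.instance Definition _ (u : dual E) :=
  GRing.isLinear.Build R E R^o *:%R (dual_fun u) (dual_linear u).

Lemma dualD (u : dual E) x y : u (x + y) = u x + u y :> R.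
Proof. exact: linearD. Qed.

Lemma dualZ (u : dual E) a x : u (a *: x) = a * u x :> R.
Proof. exact: linearZ_LR. Qed.

Lemma ler_dual_norm (u : dual E) x : `|u x| <= `|u| * `|x|.
Proof.
have [->|x0] := eqVneq x 0; first by rewrite linear0 !normr0 mulr0.
have nx : 0 < `|x| by rewrite normr_gt0.
rewrite -ler_pdivrMr// -[X in _ / X]normr_id -normf_div mulrC -[_ * _]/(_ *: (u x : R^o)).
rewrite -linearZ; apply: sup_norm_on_ub.
  have [M uM] := dual_bounded u; exists `|M| => y /= y1.
  rewrite (le_trans (uM y))// (le_trans (ler_norm _))// normrM normr_id.
  by rewrite ler_piMr.
by rewrite /= normrZ normfV normr_id mulVf// gt_eqF.
Qed.

Lemma dual_norm_ler (u : dual E) M :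
  0 <= M -> (forall x, u x <= M * `|x|) -> `|u| <= M.
Proof.
move=> M0 uM; apply: sup_norm_on_le => // x /= x1.
have M1 : M * `|x| <= M by rewrite ler_piMr.
rewrite ler_norml (le_trans (uM x))// andbT lerNl -linearN.
by rewrite (le_trans (uM _))// normrN.
Qed.

Lemma convex_hahn_banach_dual (K : R) (C : set (E * R^o)) : 0 <= K ->
  convex_set (C : set (convex_lmodType (E * R^o)%type)) ->
  (forall w, C w -> 0 <= w.2 + K * `|w.1|) ->
  exists2 u : dual E, `|u| <= K & forall w, C w -> u w.1 <= w.2.
Proof.
move=> K0 cC CK.
have sN : sublinear (fun x : E => K * `|x|).
  split=> [x y|a x a0]; first by rewrite -mulrDr ler_wpM2l// ler_normD.
  by rewrite normrZ ger0_norm// mulrCA.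
have [w|u [lu uN uC]] := convex_hahn_banach sN cC.
  by rewrite normrN; exact: CK.
pose f : {linear E -> R^o} := HB.pack u (GRing.isLinear.Build _ _ _ _ _ lu).
have uD : u \in @dual_pred R E.
  apply/asboolP; split => //; apply/(linear_bounded_continuous f).
  apply/linear_boundedP; near=> r => x.
  have Kr : K * `|x| <= r * `|x| by rewrite ler_wpM2r.
  rewrite ler_norml (le_trans (uN x))// andbT lerNl -[- _](linearN f).
  by rewrite (le_trans (uN _))// normrN.
by exists (Dual uD); first exact: dual_norm_ler.
Unshelve. all: by end_near. Qed.

End convex_hahn_banach_normed.

(** * Separation in the weak^* topology of X^* x R *)

Lemma sub_convex_hull (R : realType) (V : lmodType R) (A : set V) : A `<=` convex_hull A.
Proof. exact: sub_gen_smallest. Qed.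

Lemma convex_hull_convex (R : realType) (V : lmodType R) (A : set V) :
  convex_set (convex_hull A : set (convex_lmodType V)).
Proof.
move=> x y t; rewrite !inE => Ax Ay C [cC AC].
have := cC x y t; rewrite !inE; apply.
  by apply: Ax.
by apply: Ay.
Qed.

Section weakstar.
Context {R : realType} {X : normedModType R}.
Implicit Types (w : dual X * R^o) (A : set (dual X * R^o)).
Local Notation eval := (@pair_functional R X).

(** A weak^* neighbourhood only tests finitely many points of X x R.  The
    filter F generated by the approximations of w within A converges to w
    pointwise, which is convergence in the product topology. *)
Lemma weakstar_closure_approx A w :
  (forall (s : seq (X * R^o)%type) (e : R), 0 < e ->
    exists2 v, A v & forall z, z \in s -> `|eval v z - eval w z| < e) ->
  weakstar_closure A w.
Proof.
move=> Aw.
pose near_on (i : seq (X * R^o)%type * R) :=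
  [set v | A v /\ forall z, z \in i.1 -> `|eval v z - eval w z| < i.2].
pose F : set_system (dual X * R^o)%type := filter_from [set i | 0 < i.2] near_on.
have FF : ProperFilter F.
  apply: filter_from_proper; last by move=> [s e] /= /(Aw s)[v Av vs]; exists v.
  apply: filter_from_filter; first by exists ([::], 1) => /=.
  move=> [s d] [t e] /= d0 e0; exists (s ++ t, Num.min d e).
    by rewrite /= lt_min d0.
  move=> v [Av vst]; split; split => // z zs.
    by have := vst z; rewrite mem_cat zs lt_min => /(_ isT)/andP[].
  by have := vst z; rewrite mem_cat zs orbT lt_min => /(_ isT)/andP[].
move=> B [_ [[Q Qop <-] Qw QB]].
have Feval : eval @ F --> eval w.
  apply/cvg_sup => z U [_ [[D Dop <-] Dw DU]].
  have /nbhs_ballP[e /= e0 eD] : nbhs (eval w z) D by exact: open_nbhs_nbhs.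
  exists ([:: z], e) => //= v [_ /(_ z)]; rewrite mem_seq1 eqxx => /(_ isT) vz.
  by apply: DU; apply: eD; rewrite /ball /= distrC.
have [p p0 pQ] : F (eval @^-1` Q) by apply: Feval; exact: open_nbhs_nbhs.
have [v Av vp] := Aw p.1 p.2 p0.
by exists v; split => //; apply: QB; apply: pQ.
Qed.

Lemma weakstar_closure_le A w z (M : R) :
  (forall v, A v -> eval v z <= M) -> weakstar_closure A w -> eval w z <= M.
Proof.
move=> AM clAw; rewrite leNgt; apply/negP => Mw.
have evalC : continuous ((fun f : {ptws (X * R^o)%type -> R^o} => f z) \o
    (eval : initial_topology eval -> _)).
  by move=> v; apply: continuous_comp; [exact: initial_continuous|exact: proj_continuous].
have [v [Av /=]] : A `&` [set v | M < eval v z] !=set0.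
  by apply: clAw; exact: (evalC w _ (lt_nbhsr Mw)).
by rewrite ltNge AM.
Qed.

Lemma pair_functional_linear w : linear (eval w : (X * R^o)%type -> R^o).
Proof.
move=> a [x s] [y t]; rewrite /pair_functional /= linearP /=.
rewrite -[a *: s]/(a * s) -![a *: (_ : R^o)]/(a * _); ring.
Qed.

Lemma pair_functional_combination (a b : R) v w z :
  eval (a *: v + b *: w) z = a * eval v z + b * eval w z.
Proof.
rewrite /pair_functional -[LHS]/((a * v.1 z.1 + b * w.1 z.1) + (a * v.2 + b * w.2) * z.2).
ring.
Qed.

(** If w is not in the closure, some finite set s of points of X x R keeps A at
    a distance e from w in the seminorm given by the sum over s of the absolute
    values at the points of s.  Hahn-Banach in the space of all functions on
    X x R then gives a linear u dominated by this seminorm over e; such a u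
    only depends on the values on s, hence is evaluation at a linear combination
    of the points of s. *)
Lemma weakstar_separation A w :
  convex_set (A : set (convex_lmodType (dual X * R^o)%type)) ->
  ~ weakstar_closure A w ->
  exists z, forall v, A v -> eval v z + 1 <= eval w z.
Proof.
move=> cA nw.
have [s [e [e0 sep]]] : exists s : seq (X * R^o)%type, exists e : R, 0 < e /\
    forall v, A v -> e <= \sum_(z <- undup s) `|eval v z - eval w z|.
  apply: contrapT => nsep; apply: nw; apply: weakstar_closure_approx => s e e0.
  apply: contrapT => nv; apply: nsep; exists s, e; split => // v Av.
  rewrite leNgt; apply/negP => ve; apply: nv; exists v => // z zs.
  apply: le_lt_trans ve; rewrite (big_rem z) ?mem_undup//= lerDl.
  by apply: sumr_ge0.
pose V := ((X * R^o)%type -> R^o) : lmodType R.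
pose N (g : V) := e^-1 * \sum_(z <- undup s) `|g z|.
have sN : sublinear N.
  split=> [g h|a g a0].
    rewrite -mulrDr ler_wpM2l ?invr_ge0 ?(ltW e0)// -big_split/=.
    by apply: ler_sum => z _; exact: ler_normD.
  rewrite /N mulrCA ler_wpM2l ?invr_ge0 ?(ltW e0)// mulr_sumr.
  by apply: ler_sum => z _; rewrite normrZ ger0_norm.
pose C : set (V * R^o) := [set gb | exists2 v, A v & gb = ((eval v : V) - eval w, -1)].
have [||u [lu uN uC]] := @convex_hahn_banach _ _ N C sN.
- apply/convex_setP => _ _ t t01 [v1 A1 ->] [v2 A2 ->].
  exists (t *: v1 + (1 - t) *: v2); first by move/convex_setP : cA; exact.
  congr pair; last by rewrite -[LHS]/(t * -1 + (1 - t) * -1 : R); ring.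
  apply/funext => z; rewrite -[LHS]/(t * (eval v1 z - eval w z) + (1 - t) * (eval v2 z - eval w z)).
  rewrite -[RHS]/(eval _ z - eval w z) pair_functional_combination.
  by ring.
- move=> _ [v Av ->] /=; rewrite /N.
  rewrite addrC subr_ge0 ler_pdivlMl// mulr1 (le_trans (sep _ Av))//.
  by apply: ler_sum => z _; rewrite -[leLHS]normrN.
pose f : {linear V -> R^o} := HB.pack u (GRing.isLinear.Build _ _ _ _ _ lu).
(* zs is the separating point: u g is a combination of the g z for z in s, with
   the values of u at the indicators of the points of s as coefficients. *)
pose d z : V := fun y => (y == z)%:R.
pose zs := \sum_(z <- undup s) u (d z) *: z.
have uE (g : V) : u g = \sum_(z <- undup s) g z * u (d z).
  (* Both u g' and u (- g') are bounded by the seminorm of g', which is 0. *)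
  pose g' := g - \sum_(z <- undup s) g z *: d z.
  have g'0 z : z \in s -> g' z = 0.
    move=> zs'; rewrite -[g' z]/(g z - (\sum_(z <- undup s) g z *: d z) z) fct_sumE.
    rewrite (bigD1_seq z) ?mem_undup ?undup_uniq//= big1 => [|y yz].
      by rewrite addr0 -[(_ *: d z) z]/(g z * (z == z)%:R) eqxx mulr1 subrr.
    by rewrite -[(_ *: d y) z]/(g y * (z == y)%:R) eq_sym (negPf yz) mulr0.
  have Ng' a : N (a *: g') = 0.
    rewrite /N big_seq big1 ?mulr0// => z; rewrite mem_undup => /g'0 g'z.
    by rewrite -[(a *: g') z]/(a * g' z) g'z mulr0 normr0.
  have ug' : f g' = 0.
    apply/eqP; rewrite eq_le -oppr_le0 -linearN -scaleN1r -{1}[g']scale1r.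
    by rewrite -{1}(Ng' 1) -(Ng' (-1)) !uN.
  move: ug'; rewrite linearB linear_sum /= => /eqP; rewrite subr_eq0 => /eqP ->.
  by apply: eq_bigr => z _; exact: (linearZ_LR f (g z) (d z)).
have evalE v : eval v zs = u (eval v).
  pose evv : (X * R^o)%type -> R^o := eval v.
  pose lin := GRing.isLinear.Build R _ _ _ evv (pair_functional_linear v).
  pose ev : {linear (X * R^o)%type -> R^o} := HB.pack evv lin.
  rewrite uE -[LHS]/(ev zs) linear_sum; apply: eq_bigr => z _.
  by rewrite linearZ_LR mulrC.
exists zs => v Av; rewrite !evalE.
have := uC ((eval v : V) - eval w, -1); rewrite /= -[u (_ - _)]/(f (_ - _)) linearB.
have Cv : C ((eval v : V) - eval w, -1) by exists v.
by move=> /(_ Cv) /=; lra.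
Qed.
End weakstar.

(** * The Fenchel-Moreau theorem *)

Section fenchel_moreau.
Context {R : realType} {X : normedModType R}.
Implicit Types (f : X -> \bar R) (u : dual X).

Lemma convex_efun_le f x y (a b t : R) : convex_efun f -> 0 <= t <= 1 ->
  (f x <= a%:E)%E -> (f y <= b%:E)%E ->
  (f (t *: x + (1 - t) *: y)%R <= (t * a + (1 - t) * b)%:E)%E.
Proof.
move=> fc t01 fx fy; apply: le_trans (fc x y t t01) _.
move/andP : t01 => [t0 t1].
by rewrite [leRHS]EFinD !EFinM leeD// lee_wpmul2l// lee_fin// subr_ge0.
Qed.

Lemma proper_fun_fin f : proper_fun f -> exists x r, f x = r%:E.
Proof.
move=> [fNy [x]]; have := fNy x; case fx : (f x) => [r||]// _ _.
by exists x, r.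
Qed.

(** Lower semicontinuity bounds f from below by f(x0) - 1 on a ball of radius e
    around a point x0 of finiteness.  For w outside this ball, convexity along
    the segment from x0 to w extends the bound with the slope 2 / e: otherwise
    the point of the segment at the distance e / 2 from x0 would violate it. *)
Lemma norm_minorant f :
  proper_fun f -> lower_semicontinuous f -> convex_efun f ->
  exists a K : R, 0 <= K /\ forall w, ((a - K * `|w|)%:E <= f w)%E.
Proof.
move=> fp flsc fc; have [x0 [r fx0]] := proper_fun_fin fp.
have [|U /nbhs_ballP[e /= e0 eU] Uf] := flsc x0 (r - 1).
  by rewrite fx0 lte_fin ltrBlDr ltrDl.
have K0 : 0 <= 2 / e by rewrite divr_ge0// ltW.
exists (r - 1 - 2 / e * `|x0|), (2 / e); split => // w.
have wx0 : 2 / e * `|w - x0| <= 2 / e * `|w| + 2 / e * `|x0|.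
  by rewrite -mulrDr ler_wpM2l// ler_normB.
suff : ((r - 1 - 2 / e * `|w - x0|)%:E <= f w)%E.
  by apply: le_trans; rewrite lee_fin; lra.
have [we|ew] := ltP `|w - x0| e.
  apply: le_trans (ltW (Uf w _)); first by rewrite lee_fin gerBl mulr_ge0.
  by apply: eU; rewrite -ball_normE /= distrC.
case fw : (f w) => [s||]; [|exact: leey|by have := fp.1 w; rewrite fw].
have d0 : 0 < `|w - x0| := lt_le_trans e0 ew.
pose t := e / 2 / `|w - x0|.
have t0 : 0 < t by rewrite !divr_gt0.
have t1 : t <= 1 by rewrite ler_pdivrMr// mul1r; lra.
have /Uf : U (t *: w + (1 - t) *: x0).
  apply: eU; rewrite -ball_normE /= -normrN opprB.
  rewrite scalerBl scale1r -addrA [_ - x0]addrAC subrr add0r -scalerBr normrZ gtr0_norm//.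
  by rewrite /t divfK ?gt_eqF//; lra.
move=> /lt_le_trans /(_ (convex_efun_le fc _ (_ : f w <= s%:E)%E (_ : f x0 <= r%:E)%E)).
rewrite fw fx0 (ltW t0) t1 => /(_ isT (lexx _) (lexx _)).
rewrite !lte_fin lee_fin => h.
have tE : t * (2 / e * `|w - x0|) = 1 by rewrite /t; field; rewrite !gt_eqF.
rewrite -(ler_pM2l t0); nra.
Qed.

(** When b < c < f(x), a slope K large enough makes c - K ||w - x|| <= f(w) for
    all w: near x by lower semicontinuity, far from x by [norm_minorant].
    Hahn-Banach inserts an affine function of value c at x between these two
    functions, and its linear part u satisfies u(x) - f^*(u) >= c > b. *)
Theorem fenchel_moreau f x (b : R) :
  proper_fun f -> lower_semicontinuous f -> convex_efun f ->
  (forall u g, gph_conj f (u, g) -> u x - g <= b) -> (f x <= b%:E)%E.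
Proof.
move=> fp flsc fc fb; rewrite leNgt; apply/negP => bfx.
have [c bc cfx] : exists2 c, b < c & (c%:E < f x)%E.
  case fxE : (f x) bfx => [r||]//; last by exists (b + 1); rewrite ?ltry// ltrDl.
  by rewrite lte_fin => br; exists ((b + r) / 2); rewrite ?lte_fin; lra.
have [a [K0 [K0ge0 fK0]]] := norm_minorant fp flsc fc.
have [U /nbhs_ballP[e /= e0 eU] Uf] := flsc x c cfx.
pose K := K0 + `|c - a + K0 * `|x| | / e.
have K0K : K0 <= K by rewrite lerDl divr_ge0// ltW.
pose C : set (X * R^o) :=
  [set wr | exists w s, (f w <= s%:E)%E /\ wr = (w - x, s - c)].
have [|||u _ uC] := @convex_hahn_banach_dual R X K C.
- exact: le_trans K0K.
- apply/convex_setP => _ _ t t01 [w [s [fw ->]]] [y [r [fy ->]]].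
  exists (t *: w + (1 - t) *: y), (t * s + (1 - t) * r); split.
    exact: convex_efun_le.
  congr pair.
    rewrite -[LHS]/(t *: (w - x) + (1 - t) *: (y - x)).
    by rewrite !scalerBr addrACA -opprD -scalerDl [t + _]addrC subrK scale1r.
  by rewrite -[LHS]/(t * (s - c) + (1 - t) * (r - c)); ring.
- move=> _ [w [s [fw ->]]] /=.
  have [we|ew] := ltP `|w - x| e.
    have /Uf/lt_le_trans/(_ fw) : U w by apply: eU; rewrite -ball_normE /= distrC.
    rewrite lte_fin => cs; have := mulr_ge0 (le_trans K0ge0 K0K) (normr_ge0 (w - x)).
    by lra.
  have := le_trans (fK0 w) fw; rewrite lee_fin => aw.
  have wx : K0 * `|w| <= K0 * `|w - x| + K0 * `|x|.
    by rewrite -mulrDr ler_wpM2l// -[in leLHS](subrK x w) ler_normD.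
  have Ke : `|c - a + K0 * `|x| | <= (K - K0) * `|w - x|.
    have -> : K - K0 = `|c - a + K0 * `|x| | / e by rewrite /K; ring.
    by rewrite -mulrA ler_peMr// ler_pdivlMl// mulr1.
  have := ler_norm (c - a + K0 * `|x|); lra.
have uE y s : (f y <= s%:E)%E -> u y - s <= u x - c.
  move=> fy; have := uC (y - x, s - c); rewrite /= linearB => uyx.
  suff : C (y - x, s - c) by move=> /uyx; lra.
  by exists y, s.
have conj_le : (conjugate f u <= (u x - c)%:E)%E.
  apply: ge_ereal_sup => _ [y _ <-].
  case fy : (f y) => [s||]; last by have := fp.1 y; rewrite fy.
    by rewrite lee_fin uE// fy.
  by rewrite leNye.
have [x0 [r fx0]] := proper_fun_fin fp.
have conj_ge : ((u x0 - r)%:E <= conjugate f u)%E.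
  by apply: ereal_sup_ubound; exists x0 => //; rewrite fx0.
case cE : (conjugate f u) conj_le conj_ge => [g||]//.
rewrite lee_fin => gx _.
by have := fb u g cE; lra.
Qed.

End fenchel_moreau.

(** * Slater displacement or bounded multiplier *)

Section multiplier_alternative.
Context {R : realType} {X : normedModType R} {J : Type}.
Variable f : J -> X -> \bar R.
Hypothesis f_proper : forall j, proper_fun (f j).
Hypothesis f_lsc : forall j, lower_semicontinuous (f j).
Hypothesis f_convex : forall j, convex_efun (f j).
Variable xb : X.
Hypothesis xbF : feasible f 0 xb.

Local Notation G := (\bigcup_j gph_conj (f j)).

Lemma gph_conj_feasible j u g : gph_conj (f j) (u, g) -> u xb <= g.
Proof.
rewrite /gph_conj /= => ug; rewrite -lee_fin -ug.
apply: le_trans (_ : _ <= (u xb)%:E - f j xb)%E _.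
  by rewrite leeDl// leeNr oppe0; exact: xbF.
by apply: ereal_sup_ubound; exists xb.
Qed.

(** The set C collects the pairs (w, b) for which some s makes
    v(w) + s (g - v(xb)) <= b on G, with v(w) + s (g - v(xb)) being the value
    of (v, g) at the point (w - s xb, s) of X x R.  Thus u <= b on C means that
    (u, u(xb)) is below the support function of G, so that it cannot be
    separated from the hull of G. *)
Lemma slater_or_multiplier (K : R) : 0 <= K ->
  (exists w b, b + K * `|w| < 0 /\ forall j, (f j (xb + w)%R <= b%:E)%E) \/
  (exists2 u : dual X, `|u| <= K & weakstar_closure (convex_hull G) (u, u xb)).
Proof.
move=> K0.
pose C : set (X * R^o) := [set wb |
  exists s, forall u g, G (u, g) -> u wb.1 + s * (g - u xb) <= wb.2].
have [CK|] := pselect (forall wb, C wb -> 0 <= wb.2 + K * `|wb.1|).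
  right; have [|u uK uC] := convex_hahn_banach_dual K0 _ CK.
    apply/convex_setP => [[w b]] [v c] t /andP[t0 t1] [s sC] [r rC].
    exists (t * s + (1 - t) * r) => u g ug.
    rewrite -[leRHS]/(t * b + (1 - t) * c) /= dualD !dualZ.
    have := ler_wpM2l t0 (sC u g ug).
    have := ler_wpM2l (_ : 0 <= 1 - t) (rC u g ug).
    rewrite subr_ge0 => /(_ t1) /=; lra.
  exists u => //; apply: contrapT => /weakstar_separation[|[x s] sep].
    exact: convex_hull_convex.
  have := uC (x + s *: xb, u x + s * u xb - 1).
  rewrite /= dualD dualZ.
  suff : C (x + s *: xb, u x + s * u xb - 1) by move=> /[swap]/[apply]; lra.
  exists s => v g vg; rewrite /= dualD dualZ.
  have := sep _ (sub_convex_hull vg); rewrite /pair_functional /=; lra.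
move=> /existsNP[[w b] /not_implyP[[s sC]]] /negP; rewrite -ltNge /= => bw.
(* As g - v(xb) >= 0 on G, the multiplier s may be decreased to the negative
   number - r; after division by r, the Fenchel-Moreau theorem applies. *)
left; pose r := Num.max (- s) 1.
have r0 : 0 < r by rewrite lt_max ltr01 orbT.
exists (r^-1 *: w), (r^-1 * b); split.
  by rewrite normrZ ger0_norm ?invr_ge0 ?(ltW r0)// mulrCA -mulrDr pmulr_rlt0 ?invr_gt0.
move=> j; apply: fenchel_moreau => // u g ug.
rewrite dualD dualZ.
have gu := gph_conj_feasible ug.
have rs : - r * (g - u xb) <= s * (g - u xb).
  by rewrite ler_wpM2r ?subr_ge0// lerNl le_max lexx.
have ub : u w - r * (g - u xb) <= b.
  by have := sC u g (ex_intro2 _ _ j I ug); rewrite /=; lra.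
rewrite -(ler_pM2l r0) mulrA divff ?gt_eqF// mul1r.
by rewrite addrAC mulrDr mulrA divff ?gt_eqF// mul1r; lra.
Qed.

End multiplier_alternative.

(** * The coderivative norm is a lower bound of the Lipschitz moduli *)

Section esup0_theory.
Context {R : realType}.
Implicit Types (A : set (\bar R)) (M a : \bar R).
Local Open Scope ereal_scope.

Lemma esup0_ub A a : A a -> a <= esup0 A.
Proof.
move=> Aa; rewrite /esup0; case: asboolP => [A0|_]; last exact: ereal_sup_ubound.
by move: Aa; rewrite A0.
Qed.

Lemma esup0_le A M : 0 <= M -> (forall a, A a -> a <= M) -> esup0 A <= M.
Proof.
by move=> M0 AM; rewrite /esup0; case: asboolP => // _; apply: ge_ereal_sup.
Qed.

Lemma esup0_ge0 A : (forall a, A a -> 0 <= a) -> 0 <= esup0 A.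
Proof.
move=> A0; have [E|/set0P[a Aa]] := eqVneq A set0; last exact: le_trans (A0 _ Aa) (esup0_ub Aa).
by rewrite /esup0; case: asboolP.
Qed.

End esup0_theory.

Section lip.
Context {R : realType} {Z Y : normedModType R}.

Lemma lip_ge0 (F : Z -> set Y) zb yb : (0 <= lip F zb yb)%E.
Proof. by apply: le_ereal_inf_tmp => _ [l [l0 _] <-]; rewrite lee_fin. Qed.

(** For z = zb + t x, the Lipschitz property at yb gives a point (z, y) of the
    graph with ||y - yb|| <= l t ||x||, and normality at this point reads
    t zs(x) <= ys(y - yb) <= l t ||x||. *)
Lemma coderivative_norm_le_lip (F : Z -> set Y) zb yb : F zb yb ->
  (coderivative_norm F zb yb <= lip F zb yb)%E.
Proof.
move=> Fb; apply: esup0_le; first exact: lip_ge0.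
move=> _ [zs [ys ys1 nzs] <-].
apply: le_ereal_inf_tmp => _ [l [l0 [U [V [/nbhs_ballP[e /= e0 eU] Vyb UV]]]] <-].
rewrite lee_fin; apply: dual_norm_ler => // x.
pose t := e / 2 / (`|x| + 1).
have x1 : 0 < `|x| + 1 by rewrite ltr_wpDl.
have t0 : 0 < t by rewrite !divr_gt0.
have Uz : U (zb + t *: x).
  apply: eU; rewrite -ball_normE /= opprD addrA subrr add0r normrN normrZ gtr0_norm//.
  rewrite mulrAC ltr_pdivrMr//.
  by have := mulr_ge0 (ltW e0) (normr_ge0 x); lra.
have Uzb : U zb by apply: eU; exact: ballxx.
have [//|y Fy [d /= d1 yE]] := UV _ _ Uzb Uz yb.
  by split => //; exact: nbhs_singleton.
have : t * zs x - ys (y - yb) <= 0.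
  by have := nzs (zb + t *: x, y) Fy; rewrite /= addrAC subrr add0r dualZ.
have -> : y - yb = - (l * (t * `|x|)) *: d.
  rewrite -yE !opprD !addrA !subrr !add0r normrN normrZ gtr0_norm// scaleNr.
  by [].
rewrite dualZ => h.
rewrite -(ler_pM2l t0).
have ysd : - ys d <= 1.
  rewrite -[leRHS]mulr1; apply: le_trans (ler_norm _) _; rewrite normrN.
  by apply: le_trans (ler_dual_norm _ _) _; exact: ler_pM.
have := ler_wpM2l (mulr_ge0 l0 (mulr_ge0 (ltW t0) (normr_ge0 x))) ysd; nra.
Qed.
End lip.

(** * Convex inequality systems under bounded perturbations *)

Section linfty_facts.
Context {R : realType} {J : Type}.

Lemma ler_linfty_norm (p : linfty R J) j : `|p j| <= `|p|.
Proof. by apply: sup_norm_on_ub => //; exact/linfty_predP/linftyP. Qed.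

Lemma linfty_norm_ler (p : linfty R J) M :
  0 <= M -> (forall j, `|p j| <= M) -> `|p| <= M.
Proof. by move=> M0 pM; apply: sup_norm_on_le. Qed.

Lemma linfty_cst_proof (c : R) : (fun _ : J => c : R^o) \in @linfty_pred R J.
Proof. by apply/linfty_predP; exists `|c|. Qed.

Definition linfty_cst (c : R) : linfty R J := Linfty (linfty_cst_proof c).

End linfty_facts.

Section convex_inequality_system.
Context {R : realType} {X : normedModType R} {J : Type}.
Variable f : J -> X -> \bar R.
Hypothesis f_convex : forall j, convex_efun (f j).
Variable xb : X.

(** For q near 0 and x near xb, the point xi = xb + w satisfies
    f_j(xi) - q_j <= - s with s >= K ||x - xi||, while f_j(x) - q_j <= d where
    d = ||p - q||.  By convexity the point of the segment from x to xi with
    weight t = d / (s + d) on xi is feasible for q, and its distance to x is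
    t ||x - xi|| <= t s / K <= d / K. *)
Lemma slater_lipschitz_like (K : R) w b : 0 < K -> b + K * `|w| < 0 ->
  (forall j, (f j (xb + w)%R <= b%:E)%E) ->
  lipschitz_like (feasible f) 0 xb K^-1.
Proof.
move=> K0 bw fb; split; first by rewrite invr_ge0 ltW.
(* The slack h is shared equally between the moves of the parameter and of x. *)
pose h := - (b + K * `|w|); have h0 : 0 < h by rewrite oppr_gt0.
exists (ball (0 : linfty R J) (h / 2)), (ball xb (h / 2 / K)); split.
- by apply: nbhsx_ballx; rewrite divr_gt0.
- by apply: nbhsx_ballx; rewrite !divr_gt0.
move=> p q _; rewrite -!ball_normE /= sub0r normrN => qh x [px /= xh].
pose xi := xb + w; pose d := `|p - q|; pose s := - b - `|q|.
have Kxi : K * `|x - xi| <= s.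
  have : `|x - xi| <= `|xb - x| + `|w|.
    by rewrite opprD addrA -[`|xb - x|]normrN opprB ler_normB.
  rewrite -(ler_pM2l K0) => /le_trans; apply.
  by move: xh; rewrite ltr_pdivlMr// /s; rewrite /h in qh *; lra.
have s0 : 0 < s.
  have := mulr_ge0 (ltW K0) (normr_ge0 w); move: qh; rewrite /s /h; lra.
have d0 : 0 <= d := normr_ge0 _.
have sd0 : 0 < s + d by rewrite ltr_wpDr.
pose t := d / (s + d).
have t01 : 0 <= t <= 1.
  by rewrite divr_ge0 ?(ltW sd0)//= ler_pdivrMr// mul1r lerDr ltW.
have ts : t * s <= d.
  by rewrite /t mulrAC ler_pdivrMr// ler_wpM2l// lerDl.
exists (t *: xi + (1 - t) *: x).
  move=> j /=; have qj := ler_linfty_norm q j.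
  have pq := ler_linfty_norm (p - q) j.
  apply: le_trans (convex_efun_le (f_convex j) t01 (fb j) (px j)) _.
  rewrite lee_fin.
  have pqj : p j <= q j + d.
    by rewrite -lerBlDl; apply: le_trans pq; exact: ler_norm.
  have bqj : b <= q j - s.
    have := ler_norm (- q j); rewrite normrN /s; move: qj; lra.
  move/andP : (t01) => [t0 t1].
  have h1 := ler_wpM2l t0 bqj.
  have h2 : (1 - t) * p j <= (1 - t) * (q j + d) by rewrite ler_wpM2l// subr_ge0.
  have h3 : t * s + t * d = d by rewrite -mulrDr /t divfK// gt_eqF.
  apply: le_trans (lerD h1 h2) _; lra.
exists ((K * t / d) *: (x - xi)).
  have [dz|dn0] := eqVneq d 0; first by rewrite dz invr0 mulr0 scale0r /= normr0.
  have dp : 0 < d by rewrite lt_def dn0.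
  move/andP : (t01) => [t0 _].
  have Kt : 0 <= K * t / d by apply: divr_ge0 => //; apply: mulr_ge0 => //; exact: ltW.
  rewrite /= normrZ ger0_norm//.
  rewrite mulrAC ler_pdivrMr// mul1r mulrAC [K * _ * t]mulrC.
  exact: le_trans (ler_wpM2l t0 Kxi) ts.
have -> : (K^-1 * `|p - q|) *: ((K * t / d) *: (x - xi)) = t *: (x - xi).
  rewrite scalerA; congr (_ *: _).
  have [dz|dn0] := eqVneq d 0; first by rewrite /t -/d dz !mul0r mulr0 mul0r.
  by rewrite -/d; field; rewrite dn0 gt_eqF.
by rewrite addrAC -scalerDr [xi + _]addrC subrK -scalerDl [t + _]addrC subrK scale1r.
Qed.

Hypothesis xbF : feasible f 0 xb.
Local Notation G := (\bigcup_j gph_conj (f j)).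

(** Fenchel-Young on each graph; the bound defines a half-space. *)
Lemma fenchel_young_hull x (M : R) v : (forall j, (f j x <= M%:E)%E) ->
  convex_hull G v -> v.1 x - v.2 <= M.
Proof.
move=> fM; pose H : set (dual X * R^o) := [set v : dual X * R^o | v.1 x - v.2 <= M].
apply: (_ : convex_hull G `<=` H); apply: smallest_sub.
  apply/convex_setP => u v' t /andP[t0 t1] /(ler_wpM2l t0) Hu Hv.
  have := ler_wpM2l (_ : 0 <= 1 - t) Hv; rewrite subr_ge0 => /(_ t1) {}Hv.
  rewrite /H /= -[leLHS]/(t * u.1 x + (1 - t) * v'.1 x - (t * u.2 + (1 - t) * v'.2)).
  lra.
move=> [u g] [j _ ug]; rewrite /H /=.
have : ((u x)%:E - f j x <= g%:E)%E.
  by rewrite -[g%:E]ug; apply: ereal_sup_ubound; exists x.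
have := fM j; case: (f j x) => [r||]//.
by rewrite -EFinB !lee_fin; lra.
Qed.

(** The functional ps has the part of a weak^* limit of convex combinations of
    the functionals p |-> - p_j.  Letting p + t 1 range over all real t forces ps(1) = -1, and
    the bound that Hahn-Banach requires is [fenchel_young_hull] with
    M = ||p + t 1|| - t, as p_j + t <= ||p + t 1||. *)
Lemma multiplier_normal (u : dual X) : weakstar_closure (convex_hull G) (u, u xb) ->
  exists ps : dual (linfty R J), ps (linfty_cst 1) = -1 :> R /\
    forall p x, feasible f p x -> ps p + (u x - u xb) <= 0 :> R.
Proof.
move=> Wu.
pose C : set (linfty R J * R^o) := [set pb | exists p x (t : R),
  feasible f p x /\ pb = (p + t *: linfty_cst 1, u xb - u x - t)].
have [||ps _ psC] := @convex_hahn_banach_dual R (linfty R J) 1 C ler01.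
- apply/convex_setP => _ _ t t01 [p [x [r [px ->]]]] [q [y [s [qy ->]]]].
  exists (t *: p + (1 - t) *: q), (t *: x + (1 - t) *: y), (t * r + (1 - t) * s).
  split=> [j|]; first exact: convex_efun_le.
  congr pair.
    rewrite -[LHS]/(t *: (p + r *: linfty_cst 1) + (1 - t) *: (q + s *: linfty_cst 1)).
    by rewrite !scalerDr addrACA !scalerA -scalerDl.
  rewrite -[LHS]/(t * (u xb - u x - r) + (1 - t) * (u xb - u y - s)) dualD !dualZ.
  by ring.
- move=> _ [p [x [t [px ->]]]] /=; rewrite mul1r.
  suff : u x - u xb <= `|p + t *: linfty_cst 1| - t by lra.
  have := @weakstar_closure_le R X (convex_hull G) (u, u xb) (x, -1)
    (`|p + t *: linfty_cst 1| - t) _ Wu.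
  rewrite /pair_functional /= mulrN1; apply=> v Gv; rewrite mulrN1.
  apply: fenchel_young_hull Gv => j; apply: le_trans (px j) _; rewrite lee_fin lerBrDr.
  apply: le_trans (le_trans (ler_norm _) (ler_linfty_norm _ j)).
  by rewrite -[leRHS]/(p j + t * 1) mulr1.
have psE p x (t : R) : feasible f p x -> ps p + t * ps (linfty_cst 1) <= u xb - u x - t.
  by move=> px; rewrite -dualZ -dualD; apply: (psC (_, _)); exists p, x, t.
exists ps; split.
  have := psE 0 xb 1 xbF; have := psE 0 xb (-1) xbF.
  rewrite linear0 => h1 h2; apply/eqP; rewrite eq_le; apply/andP; split; lra.
by move=> p x /psE-/(_ 0); lra.
Qed.

(** When u = 0 every nonnegative multiple of ps is in the coderivative at 0, which accounts
    for the value 1 / 0 = +oo. *)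
Lemma inv_norm_le_coderivative (u : dual X) : weakstar_closure (convex_hull G) (u, u xb) ->
  ((`|u|%:E)^-1 <= coderivative_norm (feasible f) 0%R xb)%E.
Proof.
move=> /multiplier_normal[ps [ps1 psN]].
have le_cod s : 0 <= s -> s * `|u| <= 1 ->
    (s%:E <= coderivative_norm (feasible f) 0%R xb)%E.
  move=> s0 su; apply: (@le_trans _ _ (`|s *: ps|%:E)%E).
    rewrite lee_fin normrZ ger0_norm// ler_peMr//.
    have := ler_dual_norm ps (linfty_cst 1); rewrite ps1 normrN1 => /le_trans; apply.
    by rewrite ler_piMr// linfty_norm_ler// => j; rewrite /= normr1.
  apply: esup0_ub; exists (s *: ps) => //; exists (- (s *: u)).
    by rewrite /= normrN normrZ ger0_norm.
  move=> [p x] /= px; rewrite opprK subr0.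
  rewrite -[leLHS]/(s * ps p + s * u (x - xb)) -mulrDr mulr_ge0_le0//.
  by rewrite linearB; exact: psN.
rewrite inver; case: ifPn => [/eqP u0|u0].
  rewrite leye_eq; apply/eqP/eqyP => r r0.
  by apply: le_cod; rewrite ?(ltW r0)// u0 mulr0.
by apply: le_cod; rewrite ?invr_ge0// mulVf.
Qed.

End convex_inequality_system.

(** If s is the supremum and e > 0, a multiplier u with ||u|| <= 1 / (s + e)
    would contribute a value above s, so [slater_or_multiplier] with
    K = 1 / (s + e) leaves the Slater displacement. *)
Lemma lip_le_esup0 (R : realType) (X : normedModType R) (J : Type)
    (f : J -> X -> \bar R) (f_proper : forall j, proper_fun (f j))
    (f_lsc : forall j, lower_semicontinuous (f j))
    (f_convex : forall j, convex_efun (f j)) (xb : X) (xbF : feasible f 0 xb) :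
  (lip (feasible f) 0%R xb <=
    esup0 [set ((`|u|%:E)^-1)%E | u in
      [set u : dual X | weakstar_closure
        (convex_hull (\bigcup_j gph_conj (f j))) (u, u xb)]])%E.
Proof.
set S := esup0 _.
have S0 : (0 <= S)%E.
  by apply: esup0_ge0 => _ [u _ <-]; rewrite inve_ge0 lee_fin.
case SE : S S0 => [s||] s0; [|exact: leey|by []].
move: s0; rewrite lee_fin => s0; apply/lee_addgt0Pr => e e0.
have r0 : 0 < s + e by rewrite ltr_wpDl.
have [|[w [b [bw fb]]]|[u ur Wu]] :=
  slater_or_multiplier f_proper f_lsc f_convex xbF (K := (s + e)^-1).
- by rewrite invr_ge0 ltW.
- apply: ereal_inf_lbound; exists (s + e) => //; rewrite -[s + e]invrK.
  by apply: slater_lipschitz_like bw fb => //; rewrite invr_gt0.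
- have : ((`|u|%:E)^-1 <= S)%E by apply: esup0_ub; exists u.
  rewrite SE inver; case: ifPn => // u0; rewrite lee_fin => us.
  have ugt0 : 0 < `|u| by rewrite lt_def u0 /=.
  move: ur; rewrite -[leRHS]div1r ler_pdivlMr// => ur.
  move: us; rewrite -[leLHS]mul1r ler_pdivrMr// => us.
  by exfalso; have := mulr_gt0 e0 ugt0; lra.
Qed.

Theorem theorem15 (R : realType) (X : completeNormedModType R)
    (J : Type) (J0 : inhabited J) (f : J -> X -> \bar R)
    (f_proper : forall j, proper_fun (f j))
    (f_lsc : forall j, lower_semicontinuous (f j))
    (f_convex : forall j, convex_efun (f j))
    (xb : X) (xbF : feasible f 0 xb) :
  let F : linfty R J -> set X := feasible f in
  let S : \bar R :=
    esup0 [set ((`|u|%:E)^-1)%E | u in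
      [set u : dual X | weakstar_closure
        (convex_hull (\bigcup_j gph_conj (f j))) (u, u xb)]] in
  (S <= coderivative_norm F 0%R xb <= lip F 0%R xb)%E /\
  (bounded_set (\bigcup_j dom_conj (f j)) \/ reflexive_space X ->
    S = coderivative_norm F 0%R xb /\ coderivative_norm F 0%R xb = lip F 0%R xb).
Proof.
move=> F S.
have cod_lip : (coderivative_norm F 0%R xb <= lip F 0%R xb)%E.
  exact: coderivative_norm_le_lip.
have lip_S : (lip F 0%R xb <= S)%E by exact: lip_le_esup0.
have S_cod : (S <= coderivative_norm F 0%R xb)%E.
  apply: esup0_le => [|_ [u Wu <-]]; last exact: inv_norm_le_coderivative.
  by apply: esup0_ge0 => _ [ps _ <-]; rewrite lee_fin.
split=> [|_]; first by rewrite S_cod.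
split; apply/eqP; rewrite eq_le.
  by rewrite S_cod (le_trans cod_lip).
by rewrite cod_lip (le_trans lip_S).
Qed.
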